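(* Consider the security game of the context in which the defender has a fixed total budget $\overline\Omega_d\ge0$: the defender (leader) chooses $\bm\pi_d\in\mathbb R^N$ with $\bm\pi_d\ge\bm 0$ and $\bm 1\cdot\bm\pi_d\le\overline\Omega_d$ in order to maximize the cost $\mathcal U_a=(\bm\kappa\circ\bm\pi_d)\cdot\bm\beta_{\text{attack}}$ of the attacker (i.e. its payoff has no penalty on the defense cost, $\eta=0$), and the attacker (follower), observing $\bm\pi_d$, chooses a successful attack $\bm\beta_{\text{attack}}$ minimizing $\mathcal U_a$. Let $\bm\beta_{\text{attack},1},\dots,\bm\beta_{\text{attack},t_0}$ ($t_0\ge1$) be the list of all successful attacks with $\beta_{\text{attack}}^{(i)}=0$ for all $i\in\mathcal V\setminus\mathcal V_{\text{pin}}$, and let $\mathcal M\in\mathbb R^{t_0\times N}$ be the matrix whose $i$-th row is $(\bm\kappa\circ\bm\beta_{\text{attack},i})'$. Then the optimal defender strategy $\bm\pi_d^\star$ is given by solving the linear program $$\min_{\bm\pi_d\in\mathbb R^N,\ \epsilon\in\mathbb R}\ \epsilon\quad\text{s.t.}\quad \mathcal M\bm\pi_d\ge-\epsilon\bm 1,\quad \bm\pi_d\ge\bm 0,\quad \bm 1\cdot\bm\pi_d\le\overline\Omega_d.$$ That is, the $\bm\pi_d$-component of an optimal solution of this program is an optimal strategy of the defender.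
   Context: Data: $\mathcal V=\{1,\dots,N\}$; $\mathcal A=[a_{ij}]\in\mathbb R^{N\times N}$ is the coupling matrix of a connected undirected graph on $\mathcal V$ ($a_{ij}=a_{ji}=1$ if $i\neq j$ are adjacent, $0$ if $i\neq j$ are not adjacent, $a_{ii}=-\sum_{j\ne i}a_{ij}$); $c>0$ is the coupling strength, $\bar c>0$ the identical control gain, $a_g>0$; $J[\bm f(\bar{\bm x})]\in\mathbb R^{n\times n}$ is symmetric with largest eigenvalue $\lambda_n(J[\bm f(\bar{\bm x})])$; $\lambda_{\max}$ is the largest eigenvalue of a symmetric matrix; $\circ$ is the entrywise product; $\bm 1$ is the all-ones vector; vector inequalities are entrywise. $\mathcal V_{\text{pin}}\subseteq\mathcal V$ is a given set of pinned nodes with indicator vector $\bm\beta_{\text{pin}}\in\{0,1\}^N$, such that the network without attack is synchronized: $\lambda_{\max}(\mathcal A-(\bar c/c)\,\mathrm{diag}\{\bm\beta_{\text{pin}}\})\le-\lambda_n(J[\bm f(\bar{\bm x})])/(c\,a_g)$. $\bm\kappa=[\kappa^{(1)},\dots,\kappa^{(N)}]'$ has positive entries. $\pi_d^{(i)}$ is the defense budget allocated to node $i$. A successful attack is a vector $\bm\beta_{\text{attack}}\in\{0,1\}^N$ (with $\beta_{\text{attack}}^{(i)}=1$ meaning node $i$ is compromised) satisfying $$\lambda_{\max}\Big(\mathcal A-\frac{\bar c}{c}\,\mathrm{diag}\{\bm\beta_{\text{pin}}\circ(\bm 1-\bm\beta_{\text{attack}})\}\Big)\ge-\frac{\lambda_n(J[\bm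 f(\bar{\bm x})])}{c\,a_g}.$$ An optimal defender strategy is one maximizing, over its admissible $\bm\pi_d$, the value $\min_{\bm\beta_{\text{attack}}}(\bm\kappa\circ\bm\pi_d)\cdot\bm\beta_{\text{attack}}$, the minimum being over all successful attacks. *)

(* Defs.v *)
From mathcomp Require Import all_boot all_order all_algebra.
From mathcomp Require Import boolp classical_sets reals.
From mathcomp Require Import complex.

Set Implicit Arguments.
Unset Strict Implicit.
Unset Printing Implicit Defensive.

Import Order.TTheory GRing.Theory Num.Theory.

Local Open Scope ring_scope.
Local Open Scope classical_set_scope.

Definition hadamard (R : realType) (m n : nat) (A B : 'M[R]_(m, n)) :
    'M[R]_(m, n) :=
  map2_mx *%R A B.

Definition dotv (R : realType) (N : nat) (u v : 'cV[R]_N) : R :=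
  \sum_(i < N) u i 0 * v i 0.

Definition lev (R : realType) (N : nat) (u v : 'cV[R]_N) : Prop :=
  forall i, u i 0 <= v i 0.

Definition ones (R : realType) (N : nat) : 'cV[R]_N := const_mx 1.

Definition binary (R : realType) (N : nat) (b : 'cV[R]_N) : Prop :=
  forall i, b i 0 = 0 \/ b i 0 = 1.

Definition indicator (R : realType) (N : nat) (V : {set 'I_N}) : 'cV[R]_N :=
  \col_i (i \in V)%:R.

(* For a symmetric matrix of positive size this supremum is attained, by
   [lambda_max_attained] below. *)
Definition lambda_max (R : realType) (n : nat) (A : 'M[R]_n) : R :=
  sup [set l : R | eigenvalue A l].

Lemma symmetric_eigenvalue (R : realType) (n : nat) (A : 'M[R]_n) :
  (0 < n)%N -> A^T = A -> exists l, eigenvalue A l.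
Proof.
move=> n_gt0 Asym; pose C : numClosedFieldType := complex R.
pose f : {rmorphism R -> C} := complex.real_complex R.
have [z zA] := eigenvalue_closed (map_mx f A) n_gt0.
have /eigenvalueP[v vA v0] := zA.
have fconj x : (f x)^* = f x.
  by apply/CrealP; apply/complex.complex_realP; exists x.
have : z \is Num.real.
  apply/CrealP; pose w := map_mx Num.conj v^T.
  have Aw : map_mx f A *m w = z^* *: w.
    have fAT : (map_mx f A)^T = map_mx f A by rewrite map_trmx Asym.
    have fAc : map_mx Num.conj (map_mx f A) = map_mx f A.
      by apply/matrixP=> i j; rewrite !mxE fconj.
    have := congr1 (fun X : 'rV_n => map_mx Num.conj X^T) vA.
    by rewrite trmx_mul fAT map_mxM fAc linearZ map_mxZ.
  have : z *: (v *m w) = z^* *: (v *m w).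
    by rewrite scalemxAl -vA -mulmxA Aw scalemxAr.
  move=> /matrixP /(_ 0 0); rewrite [LHS]mxE [RHS]mxE => /esym /mulIf; apply.
  by rewrite -dotmxE gt_eqF // dotmx_is_dotmx.
move=> /complex.complex_realP[l zl]; exists l.
by rewrite -(eigenvalue_map f) -[f l]zl.
Qed.

Lemma seq_max (R : realType) (s : seq R) x0 : x0 \in s ->
  exists2 m, m \in s & forall x, x \in s -> x <= m.
Proof.
elim: s x0 => // a s IH x0 _; case: s IH => [_|b s /(_ b)[|m ms mP]].
- by exists a; rewrite ?mem_head // => x; rewrite inE => /eqP->.
- by rewrite mem_head.
have [am|/ltW ma] := leP a m.
  by exists m; [rewrite inE ms orbT|move=> x; rewrite inE => /orP[/eqP->//|/mP]].
exists a; first by rewrite mem_head.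
by move=> x; rewrite inE => /orP[/eqP->//|/mP/le_trans->].
Qed.

Lemma lambda_max_attained (R : realType) (n : nat) (A : 'M[R]_n) :
  (0 < n)%N -> A^T = A ->
  eigenvalue A (lambda_max A) /\
  forall l, eigenvalue A l -> l <= lambda_max A.
Proof.
move=> n_gt0 Asym; pose C : numClosedFieldType := complex R.
pose f : {rmorphism R -> C} := complex.real_complex R.
have [rs prs] := closed_field_poly_normal (char_poly (map_mx f A)).
pose s := [seq x <- [seq complex.Re r | r <- rs] | eigenvalue A x].
have memS l : eigenvalue A l -> l \in s.
  move=> Al; rewrite mem_filter Al; apply/mapP; exists (f l) => //.
  have : root (char_poly (map_mx f A)) (f l).
    by rewrite -eigenvalue_root_char eigenvalue_map.
  by rewrite prs (monicP (char_poly_monic _)) scale1r root_prod_XsubC.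
have [l0 l0A] := symmetric_eigenvalue n_gt0 Asym.
have [m ms mP] := seq_max (memS _ l0A).
have mA : eigenvalue A m by move: ms; rewrite mem_filter => /andP[].
have mub : ubound [set l : R | eigenvalue A l] m by move=> l /= /memS/mP.
have -> : lambda_max A = m.
  apply/le_anti/andP; split; first by apply: ge_sup => //; exists m.
  by apply: ub_le_sup => //; exists m.
by split=> // l /memS/mP.
Qed.

Definition connected_graph (N : nat) (adj : rel 'I_N) : Prop :=
  [/\ symmetric adj, irreflexive adj & forall i j, connect adj i j].

Definition coupling (R : realType) (N : nat) (adj : rel 'I_N) : 'M[R]_N :=
  \matrix_(i, j) if i == j then - \sum_(k | k != i) (adj i k)%:R
                 else (adj i j)%:R.

Definition sync_threshold (R : realType) (n : nat) (J : 'M[R]_n) (c ag : R)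
    : R :=
  - (lambda_max J / (c * ag)).

Definition controlled_coupling (R : realType) (N : nat) (adj : rel 'I_N)
    (c cbar : R) (b : 'cV[R]_N) : 'M[R]_N :=
  coupling R adj - (cbar / c) *: diag_mx b^T.

Definition synchronized (R : realType) (N n : nat) (adj : rel 'I_N)
    (J : 'M[R]_n) (c cbar ag : R) (Vpin : {set 'I_N}) : Prop :=
  lambda_max (controlled_coupling adj c cbar (indicator R Vpin))
    <= sync_threshold J c ag.

Definition successful_attack (R : realType) (N n : nat) (adj : rel 'I_N)
    (J : 'M[R]_n) (c cbar ag : R) (Vpin : {set 'I_N}) (b : 'cV[R]_N) : Prop :=
  binary b /\
  lambda_max (controlled_coupling adj c cbar
                (hadamard (indicator R Vpin) (ones R N - b)))
    >= sync_threshold J c ag.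

Definition attacker_cost (R : realType) (N : nat) (kappa pi b : 'cV[R]_N) : R :=
  dotv (hadamard kappa pi) b.

Definition admissible (R : realType) (N : nat) (Omega : R) (pi : 'cV[R]_N)
    : Prop :=
  lev 0 pi /\ dotv (ones R N) pi <= Omega.

Definition is_minimum (R : realType) (S : set R) (v : R) : Prop :=
  S v /\ lbound S v.

(* [attack] is the set of successful attacks; [v] is the value of the
   follower's minimization problem in response to [pi]. *)
Definition follower_value (R : realType) (N : nat) (kappa : 'cV[R]_N)
    (attack : set 'cV[R]_N) (pi : 'cV[R]_N) (v : R) : Prop :=
  is_minimum [set attacker_cost kappa pi b | b in attack] v.

Definition optimal_defender_strategy (R : realType) (N : nat)
    (kappa : 'cV[R]_N) (attack : set 'cV[R]_N) (Omega : R) (pi : 'cV[R]_N)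
    : Prop :=
  admissible Omega pi /\
  exists2 v, follower_value kappa attack pi v &
    forall pi' v', admissible Omega pi' -> follower_value kappa attack pi' v' ->
      v' <= v.

Definition attack_matrix (R : realType) (N t0 : nat) (kappa : 'cV[R]_N)
    (attacks : t0.-tuple 'cV[R]_N) : 'M[R]_(t0, N) :=
  \matrix_(i, j) hadamard kappa (tnth attacks i) j 0.

Definition lp_feasible (R : realType) (N t0 : nat) (M : 'M[R]_(t0, N))
    (Omega : R) (pi : 'cV[R]_N) (eps : R) : Prop :=
  [/\ lev (- (eps *: ones R t0)) (M *m pi), lev 0 pi
    & dotv (ones R N) pi <= Omega].

Definition lp_optimal (R : realType) (N t0 : nat) (M : 'M[R]_(t0, N))
    (Omega : R) (pi : 'cV[R]_N) (eps : R) : Prop :=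
  lp_feasible M Omega pi eps /\
  forall pi' eps', lp_feasible M Omega pi' eps' -> eps <= eps'.

(* Main.v *)
(* Erasing an attack outside the pinned nodes leaves the controlled coupling
   matrix, hence success, unchanged and does not raise the attacker's cost, as
   the budgets are nonnegative. So the follower may be restricted to the listed
   attacks, and [(pi, eps)] is feasible for the linear program exactly when
   [pi] is admissible and [- eps] is a lower bound of the follower's value. *)

Require Import Defs.
From mathcomp Require Import all_boot all_order all_algebra.
From mathcomp Require Import boolp classical_sets reals.

Set Implicit Arguments.
Unset Strict Implicit.
Unset Printing Implicit Defensive.

Import Order.TTheory GRing.Theory Num.Theory.

Local Open Scope ring_scope.

Lemma attack_matrix_mulmx (R : realType) (N t0 : nat) (kappa : 'cV[R]_N)
    (attacks : t0.-tuple 'cV[R]_N) (pi : 'cV[R]_N) (k : 'I_t0) :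
  (attack_matrix kappa attacks *m pi) k 0 =
    attacker_cost kappa pi (tnth attacks k).
Proof.
by rewrite mxE; apply: eq_bigr => i _; rewrite !mxE mulrAC.
Qed.

Lemma attacker_cost_le (R : realType) (N : nat) (kappa pi b b' : 'cV[R]_N) :
  (forall i, 0 < kappa i 0) -> lev 0 pi -> lev b b' ->
  attacker_cost kappa pi b <= attacker_cost kappa pi b'.
Proof.
move=> kappa_gt0 pi_ge0 le_bb'; apply: ler_sum => i _.
rewrite ler_wpM2l // mxE mulr_ge0 ?(ltW (kappa_gt0 i)) //.
by have := pi_ge0 i; rewrite mxE.
Qed.

Section DominatedAttacks.

Variables (R : realType) (N t0 : nat) (kappa : 'cV[R]_N).
Variables (attacks : t0.-tuple 'cV[R]_N) (S : set 'cV[R]_N).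
Hypothesis kappa_gt0 : forall i, 0 < kappa i 0.
Hypothesis t0_gt0 : (0 < t0)%N.
Hypothesis attacksS : forall b, b \in attacks -> S b.
(** Abstracts the erasure of attacks outside the pinned nodes, so that the linear program is treated
    without any spectral condition. *)
Hypothesis attacks_dominate :
  forall b, S b -> exists2 b', b' \in attacks & lev b' b.

(** A finite nonempty list has a cheapest attack, and by domination and monotonicity of the cost
    nothing in [S] is cheaper. *)
Lemma follower_value_attained (pi : 'cV[R]_N) : lev 0 pi ->
  exists2 b, b \in attacks & follower_value kappa S pi (attacker_cost kappa pi b).
Proof.
(* Costs are negated so that [seq_max] yields a minimum. *)
move=> pi_ge0; pose costs := [seq - attacker_cost kappa pi b | b <- attacks].
have costs0 : - attacker_cost kappa pi (tnth attacks (Ordinal t0_gt0)) \in costs.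
  exact/map_f/mem_tnth.
have [_ /mapP[b battacks ->] bmin] := seq_max costs0.
exists b => //; split; first by exists b => //; apply: attacksS.
move=> _ [b1 /attacks_dominate[b2 b2attacks le_b21] <-].
apply: le_trans (attacker_cost_le kappa_gt0 pi_ge0 le_b21).
by rewrite -lerN2; apply: bmin; apply: map_f.
Qed.

Lemma lp_optimal_defender_strategy (Omega : R) (pi : 'cV[R]_N) (eps : R) :
  lp_optimal (attack_matrix kappa attacks) Omega pi eps ->
  optimal_defender_strategy kappa S Omega pi.
Proof.
move=> [[Mpi pi_ge0 pi_budget] eps_min]; split; first by [].
have [b /tnthP[k ->] vb] := follower_value_attained pi_ge0.
eexists; first exact: vb.
move=> pi' v' [pi'_ge0 pi'_budget] [_ v'_lb].
(* A rival value [v'] bounds every listed cost from below, so optimality of [eps] applies to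
   [- v']. *)
have /eps_min eps_le : lp_feasible (attack_matrix kappa attacks) Omega pi' (- v').
  split=> // j; rewrite attack_matrix_mulmx !mxE mulr1 opprK.
  by apply: v'_lb; exists (tnth attacks j) => //; apply/attacksS/mem_tnth.
(* Row [k] is the follower's best response to [pi], whence [v' <= - eps <= v]. *)
have := Mpi k; rewrite attack_matrix_mulmx !mxE mulr1; apply: le_trans.
by rewrite lerNr.
Qed.

End DominatedAttacks.

(** On [V] the inner mask changes nothing; off [V] the outer mask kills both sides. *)
Lemma hadamard_indicator_attack (R : realType) (N : nat) (V : {set 'I_N})
    (b : 'cV[R]_N) :
  hadamard (indicator R V) (ones R N - hadamard (indicator R V) b) =
  hadamard (indicator R V) (ones R N - b).
Proof.
by apply/colP=> i; rewrite !mxE; case: (i \in V); rewrite ?mul1r ?mul0r.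
Qed.

Theorem proposition4p2 (R : realType) (N n : nat) (adj : rel 'I_N)
    (J : 'M[R]_n) (c cbar ag : R) (Vpin : {set 'I_N})
    (kappa : 'cV[R]_N) (Omega : R)
    (t0 : nat) (attacks : t0.-tuple 'cV[R]_N) :
  (0 < N)%N -> (0 < n)%N ->
  connected_graph adj ->
  J^T = J ->
  0 < c -> 0 < cbar -> 0 < ag ->
  synchronized adj J c cbar ag Vpin ->
  (forall i, 0 < kappa i 0) ->
  0 <= Omega ->
  (0 < t0)%N ->
  uniq attacks ->
  (forall b : 'cV[R]_N,
     b \in attacks <->
     successful_attack adj J c cbar ag Vpin b /\
     (forall i, i \notin Vpin -> b i 0 = 0)) ->
  forall (pi : 'cV[R]_N) (eps : R),
    lp_optimal (attack_matrix kappa attacks) Omega pi eps ->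
    optimal_defender_strategy kappa
      (successful_attack adj J c cbar ag Vpin) Omega pi.
Proof.
move=> _ _ _ _ _ _ _ _ kappa_gt0 _ t0_gt0 _ attacksP pi eps.
apply: lp_optimal_defender_strategy => // [b /attacksP[]//|b [b01 b_succ]].
(* The dominated attack is [b] erased outside [Vpin]; it lies below [b] because entries of [b] are 0
   or 1. *)
exists (hadamard (indicator R Vpin) b); last first.
  move=> i; rewrite !mxE; case: (i \in Vpin); rewrite ?mul1r ?mul0r //.
  by case: (b01 i) => ->.
apply/attacksP; split; last by move=> i /negPf iV; rewrite !mxE iV mul0r.
split; last by rewrite hadamard_indicator_attack.
move=> i; rewrite !mxE; case: (i \in Vpin); rewrite ?mul1r ?mul0r //.
by left.
Qed.
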